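(* There exists a constant $\varepsilon>0$ such that the following holds. For every non-constant monotone function $f:\{0,1\}^m\to\{0,1\}$, for every sufficiently large $n\in\mathbb{N}$, and for every $k\in\mathbb{N}$ with $2\le k\le2^{\varepsilon\cdot\sqrt{\log n}}$, it holds that $$\log\mathsf{L}(\mathit{mKW}_f\diamond\mathit{mKW}_{\textsc{Clique}_{n,k}})\ge\log\mathsf{L}(\mathit{mKW}_f)+\Omega(k),$$ $$\mathsf{CC}(U_m\diamond\mathit{mKW}_{\textsc{Clique}_{n,k}})\ge m+\Omega(k).$$
   Context: All logarithms are base 2. ''Sufficiently large $n$'' means larger than a threshold that may depend on $m$. Asymptotic convention: $A\ge B+\Omega(k)$ means that there are absolute constants $\kappa>0$ and $N_0$ such that $A\ge B+\kappa k$ whenever $k\ge N_0$. $\textsc{Clique}_{n,k}$ takes as input the adjacency matrix of an $n$-vertex (undirected) graph and outputs 1 iff the graph contains a $k$-clique. A communication problem $P\subseteq\mathcal{X}\times\mathcal{Y}\times\mathcal{O}$: Alice gets $x\in\mathcal{X}$, Bob gets $y\in\mathcal{Y}$, and they must output some $o$ with $(x,y,o)\in P$. In promise problems the protocol only needs to be correct on input pairs satisfying the promise. Protocols are deterministic binary trees; $\mathsf{CC}(P)$ is the minimal depth and $\mathsf{L}(P)$ the minimal number of leaves of a protocol solving $P$. For a non-constant monotone $h:\{0,1\}^N\to\{0,1\}$, $\mathit{mKW}_h$: Alice gets $x\in h^{-1}(1)$, Bob gets $y\in h^{-1}(0)$, and they must find $i\in[N]$ with $x_i>y_i$. For monotone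 $g:\{0,1\}^N\to\{0,1\}$, $\mathit{mKW}_f\diamond\mathit{mKW}_g$ denotes $\mathit{mKW}_{f\diamond g}$, where $f\diamond g(x_1,\dots,x_m)=f(g(x_1),\dots,g(x_m))$ for $x_i\in\{0,1\}^N$. $U_m\diamond\mathit{mKW}_g$: Alice and Bob get matrices $X,Y\in\{0,1\}^{m\times N}$. Let $a,b\in\{0,1\}^m$ be obtained by applying $g$ to each row of $X$ and $Y$ respectively. It is promised that $a\ne b$. The goal is to find $(i,j)$ such that ($a_i>b_i$ and $X_{i,j}>Y_{i,j}$), or ($a_i<b_i$ and $X_{i,j}<Y_{i,j}$), or ($a_i=b_i$ and $X_{i,j}\ne Y_{i,j}$). *)

(* Defs.v *)
From mathcomp Require Import all_boot all_order all_algebra.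
From mathcomp Require Import boolp classical_sets reals exp.

Set Implicit Arguments.
Unset Strict Implicit.
Unset Printing Implicit Defensive.

(* {0,1}^N, with the coordinates indexed by an arbitrary finite type [I];
   an m x N matrix is an element of [bits ('I_m * I)] with [I] of size N. *)
Notation bits I := {ffun I -> bool}.

Definition monotone (I : finType) (h : bits I -> bool) : Prop :=
  forall x y : bits I, (forall i, x i <= y i) -> h x <= h y.

Definition nonconstant (I : finType) (h : bits I -> bool) : Prop :=
  exists x y : bits I, h x != h y.

(* A total problem P is one whose promise is always true. *)
Record problem (X Y O : Type) := Problem {
  promise : X -> Y -> Prop;
  goal : X -> Y -> O -> Prop
}.

(* The player owning an internal node sends one bit, a function of that
   player's input; [false] leads to the first child, [true] to the second. *)
Inductive protocol (X Y O : Type) : Type :=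
| Leaf of O
| Alice of (X -> bool) & protocol X Y O & protocol X Y O
| Bob of (Y -> bool) & protocol X Y O & protocol X Y O.

Fixpoint run (X Y O : Type) (p : protocol X Y O) (x : X) (y : Y) : O :=
  match p with
  | Leaf o => o
  | Alice q p0 p1 => if q x then run p1 x y else run p0 x y
  | Bob q p0 p1 => if q y then run p1 x y else run p0 x y
  end.

Fixpoint depth (X Y O : Type) (p : protocol X Y O) : nat :=
  match p with
  | Leaf _ => 0
  | Alice _ p0 p1 | Bob _ p0 p1 => (maxn (depth p0) (depth p1)).+1
  end.

Fixpoint leaves (X Y O : Type) (p : protocol X Y O) : nat :=
  match p with
  | Leaf _ => 1
  | Alice _ p0 p1 | Bob _ p0 p1 => leaves p0 + leaves p1
  end.

Definition solves (X Y O : Type) (p : protocol X Y O) (P : problem X Y O) :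
    Prop :=
  forall x y, promise P x y -> goal P x y (run p x y).

(* Junk value 0 on the empty set. This does not arise below when m >= 1 and
   n >= 2: there are finitely many inputs, and every admissible input pair has
   a correct output, so some protocol solves the problem. *)
Definition least (A : set nat) : nat :=
  xget 0 [set n | A n /\ forall k, A k -> n <= k].

Definition CC (X Y O : Type) (P : problem X Y O) : nat :=
  least [set d | exists p : protocol X Y O, solves p P /\ depth p = d].

Definition L (X Y O : Type) (P : problem X Y O) : nat :=
  least [set l | exists p : protocol X Y O, solves p P /\ leaves p = l].

Definition mKW (I : finType) (h : bits I -> bool) :
    problem {x : bits I | h x} {y : bits I | ~~ h y} I :=
  {| promise _ _ := True;
     goal (x : {x | h x}) (y : {y | ~~ h y}) i := sval x i > sval y i |}.

Definition rowfun (J I : finType) (g : bits I -> bool) (X : bits (J * I)) :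
    bits J :=
  [ffun j => g [ffun i => X (j, i)]].

Definition compose (J I : finType) (f : bits J -> bool) (g : bits I -> bool)
    (X : bits (J * I)) : bool :=
  f (rowfun g X).

Definition mKW_compose (J I : finType) (f : bits J -> bool)
    (g : bits I -> bool) :=
  mKW (compose f g).

Definition U_compose_mKW (m : nat) (I : finType) (g : bits I -> bool) :
    problem (bits ('I_m * I)) (bits ('I_m * I)) ('I_m * I) :=
  {| promise (X Y : bits ('I_m * I)) := rowfun g X <> rowfun g Y;
     goal (X Y : bits ('I_m * I)) o :=
       let a := rowfun g X in
       let b := rowfun g Y in
       [\/ a o.1 > b o.1 /\ X o > Y o,
           a o.1 < b o.1 /\ X o < Y o
         | a o.1 = b o.1 /\ X o <> Y o] |}.

(* The adjacency matrix of an undirected graph is determined by one bit for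
   each of the 'C(n, 2) unordered pairs of distinct vertices. *)
Definition edge (n : nat) : finType := {e : {set 'I_n} | #|e| == 2}.

Definition clique (n k : nat) (G : bits (edge n)) : bool :=
  [exists S : {set 'I_n},
     (#|S| == k) && [forall e : edge n, (val e \subset S) ==> G e]].

Definition log2 (R : realType) (x : R) : R := (ln x / ln 2)%R.

(* Main.v *)
(* The threshold on n may depend on m, so it suffices to bound mKW_Clique, which
   embeds into both composed problems by repeating rows: every protocol for it
   has at least 2^(lam + 2^b) leaves when 2^b < k <= 2^(b+1) and
   n >= 2^(25 b^2), 2^(lam^2); then lam absorbs m and log L(mKW_f).

   The bound is a rank argument for the pigeonhole principle with 2^b + 1
   pigeons and 2^b holes.  Bit q of the holes is given by an equality gadget
   [x_q = y_q] over an alphabet of size N = 2^(4b + lam).  Weight an input pair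
   with match set E by (-1)^|E| p(E), where p is a signed measure whose low
   order marginals are proportional to the uniform distribution on injections.
   By Moebius inversion the rank of the resulting matrix is governed by the
   partial sums of p below a set S.  The total sum is nonzero, so the rank is at
   least N^|Q|.  Where two fixed pigeons collide, the sum vanishes as soon as S
   contains all the bits of a third pigeon, so on a leaf the rank is at most
   2^|Q| N^(|Q| - (2^b - 1)). *)
Require Import Defs.
From mathcomp Require Import all_boot all_order all_algebra.
From mathcomp Require Import boolp classical_sets reals exp.
From mathcomp Require Import fintype finset.
From mathcomp Require Import zify.
Import Order.TTheory GRing.Theory Num.Theory.
Set Implicit Arguments.
Unset Strict Implicit.
Unset Printing Implicit Defensive.
Local Open Scope ring_scope.
Local Open Scope set_scope.

(** * Rank and protocols *)

Definition rank_le (X Y : Type) (M : X -> Y -> rat) (r : nat) : Prop :=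
  exists (u : 'I_r -> X -> rat) (w : 'I_r -> Y -> rat),
    forall x y, M x y = \sum_t u t x * w t y.

Lemma rank_le_ext (X Y : Type) (M M' : X -> Y -> rat) r :
  (forall x y, M' x y = M x y) -> rank_le M r -> rank_le M' r.
Proof. by move=> eqM [u [w Muw]]; exists u, w => x y; rewrite eqM. Qed.

Lemma rank_le0 (X Y : Type) r : rank_le (fun (_ : X) (_ : Y) => 0) r.
Proof.
exists (fun _ _ => 0), (fun _ _ => 0) => x y.
by rewrite big1 // => t _; rewrite mul0r.
Qed.

Lemma rank_leD (X Y : Type) (M M' : X -> Y -> rat) r r' :
  rank_le M r -> rank_le M' r' -> rank_le (fun x y => M x y + M' x y) (r + r').
Proof.
move=> [u [w Muw]] [u' [w' Muw']].
exists (fun t => match split t with inl i => u i | inr i => u' i end).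
exists (fun t => match split t with inl i => w i | inr i => w' i end).
move=> x y; rewrite big_split_ord Muw Muw' /=; congr (_ + _).
  apply: eq_bigr => t _; case: splitP => [i /= /ord_inj-> //|i /= eq_ti].
  by have := ltn_ord t; rewrite eq_ti ltnNge leq_addr.
apply: eq_bigr => t _; case: splitP => [i /= eq_ti|i /= /addnI/ord_inj-> //].
by have := ltn_ord i; rewrite -eq_ti ltnNge leq_addr.
Qed.

Lemma rank_le_leq (X Y : Type) (M : X -> Y -> rat) r r' :
  (r <= r')%N -> rank_le M r -> rank_le M r'.
Proof.
move=> le_rr' rM; rewrite -(subnKC le_rr').
by apply: rank_le_ext (rank_leD rM (rank_le0 X Y _)) => x y; rewrite addr0.
Qed.

Lemma rank_le_scale (X Y : Type) (M : X -> Y -> rat) r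
    (a : X -> rat) (b : Y -> rat) :
  rank_le M r -> rank_le (fun x y => a x * M x y * b y) r.
Proof.
move=> [u [w Muw]]; exists (fun t x => a x * u t x), (fun t y => w t y * b y).
move=> x y; rewrite Muw mulr_sumr mulr_suml.
by apply: eq_bigr => t _; rewrite !mulrA.
Qed.

Lemma rank_le_sum (X Y : Type) (I : finType) (P : pred I)
    (M : I -> X -> Y -> rat) (r : nat) :
  (forall i, P i -> rank_le (M i) r) ->
  rank_le (fun x y => \sum_(i | P i) M i x y) (#|P| * r).
Proof.
move=> rM; rewrite -sum_nat_const.
rewrite (eq_bigl (fun i => i \in enum P)) => [|i]; last by rewrite mem_enum.
rewrite -big_uniq ?enum_uniq //.
apply: rank_le_ext (_ : rank_le (fun x y => \sum_(i <- enum P) M i x y) _).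
  by move=> x y; rewrite big_enum.
have: all P (enum P) by apply/allP => i; rewrite mem_enum.
elim: (enum P) => [_|i s IHs /= /andP[Pi sP]].
  by rewrite big_nil; apply: rank_le_ext (rank_le0 _ _ _) => x y; rewrite big_nil.
rewrite big_cons.
by apply: rank_le_ext (rank_leD (rM i Pi) (IHs sP)) => x y; rewrite big_cons.
Qed.

(** Row operations do not raise rank: every new row is a linear combination of rows of [M]. *)
Lemma rank_le_rows (X X' Y : Type) (I : finType) (M : X -> Y -> rat) r
    (c : I -> rat) (g : X' -> I -> X) :
  rank_le M r -> rank_le (fun x y => \sum_i c i * M (g x i) y) r.
Proof.
move=> [u [w Muw]]; exists (fun t x => \sum_i c i * u t (g x i)), w => x y.
under eq_bigr do rewrite Muw mulr_sumr.
rewrite exchange_big /=; apply: eq_bigr => t _.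
by rewrite mulr_suml; apply: eq_bigr => i _; rewrite mulrA.
Qed.

(** At most [#|D|] distinct columns occur, one for each value of [h]. *)
Lemma rank_le_factor (X Y : Type) (T : finType) (D : pred T)
    (G : X -> T -> rat) (h : Y -> T) :
  (forall y, D (h y)) -> rank_le (fun x y => G x (h y)) #|D|.
Proof.
move=> Dh; exists (fun t x => G x (enum_val t)), (fun t y => (h y == enum_val t)%:R).
move=> x y.
rewrite -(big_enum_val (A := D) (fun t => G x t * (h y == t)%:R)) /=.
rewrite (bigD1 (h y)) /=; last exact: Dh.
rewrite eqxx mulr1 big1 ?addr0 // => t /andP[_ /negPf].
by rewrite eq_sym => ->; rewrite mulr0.
Qed.

Lemma rank_le_diag (T : finType) r :
  rank_le (fun a b : T => (a == b)%:R) r -> (#|T| <= r)%N.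
Proof.
move=> [u [w Muw]].
pose U := \matrix_(i < #|T|, t < r) u t (enum_val i).
pose W := \matrix_(t < r, j < #|T|) w t (enum_val j).
have UW : U *m W = 1%:M.
  apply/matrixP => i j; rewrite !mxE -(inj_eq enum_val_inj) Muw.
  by apply: eq_bigr => t _; rewrite !mxE.
by rewrite -[X in (X <= _)%N](mxrank1 rat) -UW (leq_trans (mxrankM_maxl _ _)) ?rank_leq_col.
Qed.

(* Rank is a formal complexity measure: it is subadditive when a rectangle is
   split by a bit of either player. *)
Lemma leaves_ge_rank (X Y O X' Y' : Type) (p : protocol X Y O)
    (alpha : X' -> X) (beta : Y' -> Y) (good : X' -> Y' -> O -> Prop)
    (M : X' -> Y' -> rat) r :
  (forall x y, good x y (run p (alpha x) (beta y))) ->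
  (forall o, exists2 Mo, rank_le Mo r & forall x y, good x y o -> M x y = Mo x y) ->
  rank_le M (leaves p * r).
Proof.
move=> pgood leaf.
suff rect (a : X' -> bool) (b : Y' -> bool) :
    (forall x y, a x -> b y -> good x y (run p (alpha x) (beta y))) ->
    rank_le (fun x y => (a x)%:R * M x y * (b y)%:R) (leaves p * r).
  have := rect predT predT (fun x y _ _ => pgood x y).
  by apply: rank_le_ext => x y; rewrite mul1r mulr1.
move=> {pgood}; elim: p a b => [o|q p0 IH0 p1 IH1|q p0 IH0 p1 IH1] a b /= pgood.
- have [Mo rMo eqM] := leaf o; rewrite mul1n.
  apply: rank_le_ext (rank_le_scale (fun x => (a x)%:R) (fun y => (b y)%:R) rMo) => x y.
  case ax: (a x); last by rewrite !mul0r.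
  case y_b: (b y); last by rewrite !mulr0.
  by rewrite eqM //; apply: pgood.
- rewrite mulnDl.
  pose a0 x := a x && ~~ q (alpha x); pose a1 x := a x && q (alpha x).
  apply: rank_le_ext (rank_leD (IH0 a0 b _) (IH1 a1 b _)).
  + by move=> x y; rewrite /a0 /a1; case: (a x); case: (q _); rewrite /= !(mul0r, mul1r, add0r, addr0).
  + by move=> x y /andP[ax /negPf qx] y_b; have := pgood x y ax y_b; rewrite qx.
  + by move=> x y /andP[ax qx] y_b; have := pgood x y ax y_b; rewrite qx.
- rewrite mulnDl.
  pose b0 y := b y && ~~ q (beta y); pose b1 y := b y && q (beta y).
  apply: rank_le_ext (rank_leD (IH0 a b0 _) (IH1 a b1 _)).
  + by move=> x y; rewrite /b0 /b1; case: (b y); case: (q _); rewrite /= !(mulr0, mulr1, add0r, addr0).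
  + by move=> x y ax /andP[y_b /negPf qy]; have := pgood x y ax y_b; rewrite qy.
  + by move=> x y ax /andP[y_b qy]; have := pgood x y ax y_b; rewrite qy.
Qed.

(** * Alternating sums and Moebius inversion on subsets *)

Lemma sum_set_pair (T : finType) (j : T) (G : {set T} -> rat) :
  \sum_D G D = \sum_(D : {set T} | j \notin D) (G D + G (j |: D)).
Proof.
rewrite (bigID (fun D : {set T} => j \notin D)) big_split /=; congr (_ + _).
rewrite (reindex_onto (fun D => j |: D) (fun D => D :\ j)) /=; last first.
  by move=> D; rewrite negbK => jD; rewrite setD1K.
apply: eq_bigl => D; rewrite negbK setU11 /=.
apply/eqP/idP => [<-|jD]; first by rewrite !inE eqxx.
by rewrite setU1K.
Qed.

Lemma alternating_sum0 (T : finType) (j : T) (F : {set T} -> rat) :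
  (forall D : {set T}, j \notin D -> F (j |: D) = F D) ->
  \sum_(D : {set T}) (-1) ^+ #|D| * F D = 0.
Proof.
move=> Fj; rewrite (sum_set_pair j) big1 // => D jD.
by rewrite cardsU1 jD Fj // exprS mulN1r mulNr subrr.
Qed.

(** The coefficients of [F] in the basis of the indicators of [S \subset E]. *)
Definition moebius (T : finType) (F : {set T} -> rat) (S : {set T}) : rat :=
  \sum_(R : {set T} | R \subset S) (-1) ^+ (#|S| + #|R|) * F R.

(** After exchanging sums, [F R] is weighted by an alternating sum over the sets between [R] and
    [E], which cancels unless [R = E]. *)
Lemma moebiusK (T : finType) (F : {set T} -> rat) (E : {set T}) :
  F E = \sum_(S : {set T} | S \subset E) moebius F S.
Proof.
pose G (R : {set T}) := \sum_(S : {set T})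
  (-1) ^+ #|S| * ((R \subset S) && (S \subset E))%:R : rat.
transitivity (\sum_(R : {set T}) (-1) ^+ #|R| * F R * G R); last first.
  under [RHS]eq_bigr do rewrite /moebius big_mkcond.
  rewrite exchange_big /=; apply: eq_bigr => R _.
  rewrite mulr_sumr [RHS]big_mkcond /=; apply: eq_bigr => S _.
  case: (S \subset E); last by rewrite andbF !mulr0.
  by case: (R \subset S); rewrite /= ?mulr0 // mulr1 exprD mulrC mulrA.
rewrite (bigD1 E) //= big1 ?addr0 => [|R neqRE].
  rewrite /G (bigD1 E) //= subxx mulr1 big1 ?addr0 => [|S neqSE].
    by rewrite mulrAC -expr2 sqrr_sign mul1r.
  by rewrite -eqEsubset eq_sym (negPf neqSE) mulr0.
have [sRE|nsRE] := boolP (R \subset E); last first.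
  rewrite /G big1 ?mulr0 // => S _; case: andP; rewrite ?mulr0 // => -[sRS sSE].
  by rewrite (subset_trans sRS sSE) in nsRE.
have /set0Pn[q] : E :\: R != set0.
  by rewrite setD_eq0; apply: contra neqRE => sER; rewrite eqEsubset sRE.
rewrite inE => /andP[nqR qE].
rewrite [G R](alternating_sum0 (j := q)) ?mulr0 // => D nqD; congr (_%:R).
rewrite subUset sub1set qE /=; congr (nat_of_bool (_ && _)).
apply/subsetP/subsetP => sR z zR; last by rewrite !inE sR ?orbT.
by have := sR z zR; rewrite !inE; case: eqP => // zq; rewrite zq (negPf nqR) in zR.
Qed.

(** * Equality gadgets *)

(** [None] matches nothing, so single entries of [x] can be erased. *)
Definition matches (Q A : finType) (x : {ffun Q -> option A})
    (y : {ffun Q -> A}) : {set Q} :=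
  [set q | x q == Some (y q)].

(* The signed sum over the ways of erasing entries of [a] to [None] turns the
   matrix into a multiple of the identity. *)
Lemma rank_matches_ge (Q A : finType) (F : {set Q} -> rat) r :
  \sum_(D : {set Q}) (-1) ^+ #|D| * F D != 0 ->
  rank_le (fun x (y : {ffun Q -> A}) => F (matches x y)) r ->
  (#|A| ^ #|Q| <= r)%N.
Proof.
set kappa := \sum_D _ => kappa0 rF.
rewrite -card_ffun; apply: rank_le_diag.
pose erase (a : {ffun Q -> A}) (D : {set Q}) :=
  [ffun q => if q \in D then Some (a q) else None].
apply: rank_le_ext (rank_le_scale (fun=> kappa^-1) (fun=> 1)
  (rank_le_rows (fun D : {set Q} => (-1) ^+ #|D|) erase rF)) => a y /=.
rewrite mulr1; have matchE D : matches (erase a D) y = D :&: [set q | a q == y q].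
  by apply/setP => q; rewrite !inE ffunE; case: (q \in D).
under eq_bigr do rewrite matchE.
have [<-|neq_ay] := eqVneq a y.
  rewrite (_ : \sum_D _ = kappa) ?mulVf //.
  apply: eq_bigr => D _; congr (_ * F _).
  by apply/setP => q; rewrite !inE eqxx andbT.
have [q neq_q] : exists q, a q != y q.
  apply/existsP; apply: contraR neq_ay; rewrite negb_exists => /forallP eq_ay.
  by apply/eqP/ffunP => q; have:= eq_ay q; rewrite negbK => /eqP.
rewrite (alternating_sum0 (j := q)) ?mulr0 // => D _; congr F.
apply/setP => q'; rewrite !inE; case: eqP => [->|//].
by rewrite (negPf neq_q) !andbF.
Qed.

(** Moebius inversion expands [F] in the functions [S \subset matches x y]. Each depends on [y] only
    through its restriction to [S], hence has rank at most [#|A| ^ #|S|]. *)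
Lemma rank_matches_le (Q A : finType) (F : {set Q} -> rat) d :
  (0 < #|A|)%N -> (forall S, moebius F S != 0 -> (#|S| <= d)%N) ->
  rank_le (fun x (y : {ffun Q -> A}) => F (matches x y)) (2 ^ #|Q| * #|A| ^ d).
Proof.
move=> A_gt0 Fd; have /card_gt0P[a0 _] := A_gt0.
pose P := [pred S : {set Q} | moebius F S != 0].
pose M (S : {set Q}) (x : {ffun Q -> option A}) (y : {ffun Q -> A}) :=
  moebius F S * (S \subset matches x y)%:R * 1.
have rM S : P S -> rank_le (M S) (#|A| ^ d).
  move=> PS; apply: (rank_le_scale (fun=> _) (fun=> 1)).
  (* Resetting the entries outside [S] to [a0] leaves [#|A| ^ #|S|] values. *)
  pose restr (y : {ffun Q -> A}) := [ffun q => if q \in S then y q else a0].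
  pose G (x : {ffun Q -> option A}) t : rat := (S \subset matches x t)%:R.
  have restrP y : restr y \in pffun_on a0 S predT.
    apply/pffun_onP; split => [|? //]; apply/subsetP => q.
    by rewrite inE ffunE; case: ifP => //; rewrite eqxx.
  have := rank_le_factor G restrP; rewrite card_pffun_on => rG.
  apply: rank_le_leq (_ : #|A| ^ #|S| <= _)%N _.
    by rewrite leq_pexp2l ?Fd.
  apply: rank_le_ext rG => x y; congr (_%:R); congr nat_of_bool.
  by apply/subsetP/subsetP => sS q qS; have:= sS q qS; rewrite !inE ffunE qS.
apply: rank_le_leq (_ : #|P| * #|A| ^ d <= _)%N _.
  rewrite leq_mul2r; apply/orP; right.
  by rewrite -[#|Q|]cardsT -card_powerset powersetT cardsT max_card.
apply: rank_le_ext (rank_le_sum rM) => x y.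
rewrite moebiusK [LHS]big_mkcond [RHS]big_mkcond /=.
apply: eq_bigr => S _; rewrite /M mulr1.
case: eqP => [->|_] /=; first by case: ifP; rewrite // mul0r.
by case: (S \subset _); rewrite ?mulr1 ?mulr0.
Qed.

(** * The pigeonhole measure *)

Definition inj_on (I C : finType) (z : I -> C) (R : {set I}) : bool :=
  #|z @: R| == #|R|.

Definition set_at (I : finType) (C : Type) (z : I -> C) (j : I) (v : C) : I -> C :=
  fun i => if i == j then v else z i.

(* A signed measure on the maps z : I -> C all of whose low order marginals are
   multiples of the uniform distribution on injections; here #|I| = #|C| + 1,
   so that no z is injective and the (truncated) weight of R = I is
   irrelevant. *)
Definition php_measure (I C : finType) (z : I -> C) : rat :=
  \sum_(R : {set I})
    (-1) ^+ #|R| * (#|C| ^ #|R| * (#|C| - #|R|)`! * inj_on z R)%:R.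

Lemma eq_php_measure (I C : finType) (z z' : I -> C) :
  z =1 z' -> php_measure z = php_measure z'.
Proof.
move=> eqz; apply: eq_bigr => R _; rewrite /inj_on.
by have -> : z @: R = z' @: R by apply: eq_imset.
Qed.

Lemma inj_onP (I C : finType) (z : I -> C) (R : {set I}) :
  reflect {in R &, injective z} (inj_on z R).
Proof. exact: imset_injP. Qed.

Lemma inj_on_set_at (I C : finType) (z : I -> C) (j : I) v (R : {set I}) :
  j \notin R -> inj_on (set_at z j v) R = inj_on z R.
Proof.
move=> jR; rewrite /inj_on.
suff -> : set_at z j v @: R = z @: R by [].
by apply: eq_in_imset => i iR; rewrite /set_at; case: eqP => // eq_ij; rewrite -eq_ij iR in jR.
Qed.

Lemma sum_inj_on_set_at (I C : finType) (z : I -> C) (j : I) (R : {set I}) :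
  j \notin R ->
  (\sum_v inj_on (set_at z j v) (j |: R) = inj_on z R * (#|C| - #|R|))%N.
Proof.
move=> jR.
have imE v : set_at z j v @: (j |: R) = v |: z @: R.
  rewrite imsetU1 {1}/set_at eqxx; congr (_ |: _).
  by apply: eq_in_imset => i iR; rewrite /set_at; case: eqP => // eq_ij; rewrite -eq_ij iR in jR.
have injE v : inj_on (set_at z j v) (j |: R) = inj_on z R && (v \notin z @: R).
  rewrite /inj_on imE !cardsU1 jR.
  case: (v \in _) => /=; last by rewrite andbT eqSS.
  rewrite andbF add0n; apply/negbTE; rewrite neq_ltn add1n ltnS.
  by rewrite leq_imset_card.
under eq_bigr do rewrite injE -mulnb.
rewrite -big_distrr /=; case: (boolP (inj_on z R)) => [/eqP <-|_]; last by rewrite !mul0n.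
rewrite !mul1n -(cardsC (z @: R)) addKn -sum1_card [RHS]big_mkcond /=; apply: eq_bigr => v _.
by rewrite inE; case: (v \in _).
Qed.

(** Pair [R] with [j |: R]: a free value at [j] gives a factor [#|C|], an injective extension a
    factor [#|C| - #|R|], and the weights make the two cancel when [#|R| < #|C|]. Only [R =
    [set~ j]] survives, as no value is left for an injective extension. *)
Lemma php_measure_marginal (I C : finType) (z : I -> C) (j : I) :
  #|I| = #|C|.+1 ->
  \sum_v php_measure (set_at z j v) =
    (-1) ^+ #|C| * (#|C| ^ #|C|.+1 * inj_on z [set~ j])%:R.
Proof.
move=> cardI; pose h := #|C|.
pose W (R : {set I}) : rat := (-1) ^+ #|R| * (h ^ #|R| * (h - #|R|)`!)%:R.
have -> : \sum_v php_measure (set_at z j v) =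
    \sum_R W R * (\sum_v inj_on (set_at z j v) R)%N%:R.
  rewrite exchange_big /=; apply: eq_bigr => R _; rewrite natr_sum mulr_sumr.
  by apply: eq_bigr => v _; rewrite natrM mulrA.
rewrite (sum_set_pair j) (bigD1 [set~ j]) /=; last by rewrite !inE eqxx.
have cardCj : #|[set~ j]| = h by rewrite cardsC1 cardI.
rewrite [X in _ + X]big1 ?addr0 => [|R /andP[jR neqR]]; rewrite sum_inj_on_set_at //.
- rewrite cardCj subnn muln0 mulr0 addr0 /W cardCj subnn fact0 muln1.
  under eq_bigr do rewrite inj_on_set_at ?inE ?eqxx //.
  by rewrite sum_nat_const -mulrA -natrM expnS mulnCA mulnA.
- by rewrite !inE eqxx.
- have ltRh : (#|R| < h)%N.
    rewrite -cardCj proper_card // properEneq neqR.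
    by apply/subsetP => i iR; rewrite !inE; apply: contraNneq jR => <-.
  under eq_bigr do rewrite inj_on_set_at //.
  rewrite sum_nat_const /W cardsU1 jR add1n exprS mulN1r !mulNr -!mulrA -!natrM.
  apply/eqP; rewrite subr_eq0; apply/eqP; congr (_ * _%:R).
  rewrite -(subnSK ltRh) factS expnS; rewrite -/h; lia.
Qed.

(** Holes are sets of bit positions, so there are [2 ^ b] of them; [slice E i] is the hole of pigeon
    [i] under the bit pattern [E]. *)
Definition slice (I : finType) (b : nat) (E : {set I * 'I_b}) (i : I) :
    {set 'I_b} :=
  [set l | (i, l) \in E].

Definition set_slice (I : finType) (b : nat) (E : {set I * 'I_b}) (j : I)
    (v : {set 'I_b}) : {set I * 'I_b} :=
  [set q | if q.1 == j then q.2 \in v else q \in E].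

Lemma slice_set_slice (I : finType) (b : nat) (E : {set I * 'I_b}) j v :
  slice (set_slice E j v) =1 set_at (slice E) j v.
Proof.
by move=> i; apply/setP => l; rewrite !inE /= /set_at; case: eqP => _; rewrite ?inE.
Qed.

Lemma sum_slice (I : finType) (b : nat) (j : I) (G : {set I * 'I_b} -> rat) :
  \sum_E G E = \sum_(E | slice E j == set0) \sum_v G (set_slice E j v).
Proof.
rewrite (partition_big (fun E => set_slice E j set0) (fun E => slice E j == set0)) /=.
  apply: eq_bigr => E /eqP Ej0.
  rewrite (reindex_onto (set_slice E j) (fun E' => slice E' j)) /=.
    apply: eq_bigl => v; rewrite slice_set_slice /set_at eqxx eqxx andbT.
    apply/eqP/setP => -[i l]; rewrite !inE /=; case: eqP => // ->.
    by have /setP/(_ l) := Ej0; rewrite !inE.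
  move=> E' /eqP <-; apply/setP => -[i l]; rewrite !inE /=.
  by case: eqP => // ->.
by move=> E _; rewrite slice_set_slice /set_at eqxx.
Qed.

(** Summing out pigeon [None] leaves a nonzero constant times the number of injective placements of
    the others, so one such placement suffices. *)
Lemma php_measure_total (b : nat) :
  \sum_(E : {set option {set 'I_b} * 'I_b}) php_measure (slice E) != 0.
Proof.
set h := #|{set 'I_b}|; have h_gt0 : (0 < h)%N by apply/card_gt0P; exists set0.
rewrite (sum_slice None).
have marg (E : {set option {set 'I_b} * 'I_b}) :
    \sum_v php_measure (slice (set_slice E None v)) =
    (-1) ^+ h * (h ^ h.+1 * inj_on (slice E) [set~ None])%:R.
  rewrite -php_measure_marginal ?card_option //.
  by apply: eq_bigr => v _; apply: eq_php_measure; apply: slice_set_slice.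
under eq_bigr do rewrite marg.
rewrite -mulr_sumr mulf_neq0 ?signr_eq0 // -natr_sum pnatr_eq0.
(* Pigeon [Some c] sits in hole [c]. *)
pose E0 : {set option {set 'I_b} * 'I_b} :=
  [set q : option {set 'I_b} * 'I_b | if q.1 is Some c then q.2 \in c else false].
rewrite (bigD1 E0) /=; last by apply/eqP/setP => l; rewrite !inE.
rewrite addn_eq0 muln_eq0 negb_and negb_or -lt0n expn_gt0 h_gt0 /=.
apply/orP; left; rewrite eqb0 negbK; apply/inj_onP.
have sE0 c : slice E0 (Some c) = c by apply/setP => l; rewrite !inE.
by move=> [c|] [c'|]; rewrite !inE ?eqxx // !sE0 => _ _ ->.
Qed.

(** The signed weight cut down to collisions of [i] and [i']; on a leaf announcing this pair the cut
    changes nothing. *)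
Definition collision_measure (I : finType) (b : nat) (i i' : I)
    (E : {set I * 'I_b}) : rat :=
  (-1) ^+ #|E| * ((slice E i == slice E i')%:R * php_measure (slice E)).

(** If [S] contained all bits of a third pigeon, summing over its hole would leave a multiple of the
    indicator that all others sit injectively, which a collision of [i] and [i'] excludes. So each
    of the [2 ^ b - 1] other pigeons has a bit outside [S]. *)
Lemma moebius_collision (I : finType) (b : nat) (i i' : I) (S : {set I * 'I_b}) :
  #|I| = (2 ^ b).+1 -> i != i' -> moebius (collision_measure i i') S != 0 ->
  (#|S| + 2 ^ b <= (2 ^ b).+1 * b + 1)%N.
Proof.
move=> cardI neq_i moebS.
have cardC : #|{set 'I_b}| = (2 ^ b)%N.
  by rewrite -cardsT -powersetT card_powerset cardsT card_ord.
have hole j : j \notin [set i; i'] -> exists l, (j, l) \notin S.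
  rewrite !inE negb_or => /andP[ji ji'].
  apply/existsP; apply: contraR moebS; rewrite negb_exists => /forallP Sj.
  rewrite /moebius big_mkcond (sum_slice j) big1 // => E /eqP Ej0.
  have subE v : (set_slice E j v \subset S) = (E \subset S).
    apply/subsetP/subsetP => sES [i0 l0] E_il.
      apply: sES; rewrite !inE /=; case: eqP => // eq_ij.
      by have /setP/(_ l0) := Ej0; rewrite !inE -eq_ij E_il.
    have [-> //|neq_ij] := eqVneq i0 j; first by have := Sj l0; rewrite negbK.
    by apply: sES; move: E_il; rewrite !inE /= (negPf neq_ij).
  have sE v k : k != j -> slice (set_slice E j v) k = slice E k.
    by move=> /negPf neq_kj; rewrite slice_set_slice /set_at neq_kj.
  (* The signs of [moebius] and [collision_measure] cancel, which leaves a marginal of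
     [php_measure]. *)
  transitivity (\sum_v (if E \subset S then (-1) ^+ #|S| *
      (slice E i == slice E i')%:R else 0) * php_measure (set_at (slice E) j v)).
    apply: eq_bigr => v _; rewrite subE; case: ifP; last by rewrite mul0r.
    rewrite /collision_measure exprD !mulrA -[_ * _ * (-1) ^+ _]mulrA -expr2.
    rewrite sqrr_sign mulr1 !sE 1?eq_sym // => _; congr (_ * _).
    by apply: eq_php_measure; apply: slice_set_slice.
  rewrite -mulr_sumr php_measure_marginal ?cardC //.
  case: (E \subset S); last by rewrite mul0r.
  have [eq_s|_] := eqVneq (slice E i); last by rewrite mulr0 mul0r.
  case: inj_onP => [/(_ i i') injE|_]; last by rewrite muln0 !mulr0.
  by case/eqP: neq_i; apply: injE; rewrite // !inE eq_sym.
have: (#|~: [set i; i']| <= #|~: S|)%N.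
  apply: leq_trans (leq_imset_card (fun q : I * 'I_b => q.1) _).
  apply/subset_leq_card/subsetP => j; rewrite inE => /hole[l Sjl].
  by apply/imsetP; exists (j, l); rewrite // inE.
have := cardsC S; have := cardsC [set i; i'].
rewrite cards2 neq_i cardI card_prod cardI card_ord; lia.
Qed.

(* Rank argument for the search problem of finding two pigeons in the same
   hole, where the bit (i, l) of the hole of pigeon i is [x (i, l) == Some (y
   (i, l))]. *)
Lemma pigeon_protocol_leaves (b : nat) (A : finType) (X Y O : Type)
    (p : protocol X Y O)
    (Q := (option {set 'I_b} * 'I_b)%type)
    (alpha : {ffun Q -> option A} -> X) (beta : {ffun Q -> A} -> Y)
    (good : {ffun Q -> option A} -> {ffun Q -> A} -> O -> Prop) :
  (0 < b)%N -> (0 < #|A|)%N ->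
  (forall x y, good x y (run p (alpha x) (beta y))) ->
  (forall x0 y0 o, good x0 y0 o -> exists i i' : option {set 'I_b}, i != i' /\
     forall x y, good x y o -> slice (matches x y) i = slice (matches x y) i') ->
  (#|A| ^ (2 ^ b - 1) <= leaves p * 2 ^ ((2 ^ b).+1 * b))%N.
Proof.
move=> b_gt0 A_gt0 pgood goodP; set h := (2 ^ b)%N.
have cardI : #|{: option {set 'I_b}}| = h.+1.
  by rewrite card_option -cardsT -powersetT card_powerset cardsT card_ord.
have cardQ : #|{: Q}| = (h.+1 * b)%N by rewrite card_prod cardI card_ord.
have h_gt0 : (0 < h)%N by rewrite expn_gt0.
(* The sign cancels the one in [rank_matches_ge], leaving the total mass of the measure. *)
pose F (E : {set Q}) : rat := (-1) ^+ #|E| * php_measure (slice E).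
pose d := (h.+1 * b + 1 - h)%N.
have leM : (#|A| ^ (h.+1 * b) <= leaves p * (2 ^ (h.+1 * b) * #|A| ^ d))%N.
  rewrite -cardQ; apply: (@rank_matches_ge _ A F).
    under eq_bigr do rewrite /F mulrA -expr2 sqrr_sign mul1r.
    exact: php_measure_total.
  apply: (leaves_ge_rank (good := good)) pgood _ => o.
  (* An output that is never good puts no condition on its leaf, and the zero matrix serves. *)
  have [[x0 [y0 g0]]|nog] := pselect (exists x y, good x y o); last first.
    by exists (fun _ _ => 0); [exact: rank_le0|move=> x y gxy; case: nog; exists x, y].
  have [i [i' [neq_i eq_i]]] := goodP _ _ _ g0.
  exists (fun x y => collision_measure i i' (matches x y)).
    rewrite cardQ; apply: rank_le_leq (rank_matches_le (d := d) A_gt0 _).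
      by rewrite cardQ.
    move=> S /(moebius_collision cardI neq_i); rewrite -/h => /(leq_sub2r h).
    by rewrite addnK => leS; exact: leS.
  by move=> x y gxy; rewrite /collision_measure (eq_i x y gxy) eqxx mul1r.
have eq_d : (h.+1 * b = d + (h - 1))%N by rewrite /d; nia.
by move: leM; rewrite {1}eq_d expnD mulnA [X in (_ <= X)%N]mulnC leq_pmul2l // expn_gt0 A_gt0.
Qed.

(** * Clique against coloring *)

Definition complete_graph (n : nat) (V : {set 'I_n}) : bits (edge n) :=
  [ffun e : edge n => val e \subset V].

Definition coloring_graph (n : nat) (C : eqType) (col : 'I_n -> C) :
    bits (edge n) :=
  [ffun e : edge n => [exists u in val e, [exists v in val e, col u != col v]]].

Lemma clique_complete_graph (n : nat) (V : {set 'I_n}) :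
  clique #|V| (complete_graph V).
Proof.
apply/existsP; exists V; rewrite eqxx /=; apply/forallP => e.
by apply/implyP => eV; rewrite ffunE.
Qed.

Lemma coloring_graph_no_clique (n k : nat) (C : finType) (col : 'I_n -> C) :
  (#|C| < k)%N -> ~~ clique k (coloring_graph col).
Proof.
move=> lt_Ck; apply/negP => /existsP[S /andP[/eqP cardS /forallP Sclique]].
have /dinjectivePn[u uS [v]] : ~~ dinjectiveb col (mem S).
  apply: contraL lt_Ck => /dinjectiveP inj_col.
  by rewrite -leqNgt -cardS -(card_in_imset inj_col) max_card.
rewrite !inE => /andP[neq_vu vS] eq_col.
have card_uv : #|[set u; v]| == 2 by rewrite cards2 (eq_sym u) neq_vu.
have := Sclique (Sub [set u; v] card_uv); rewrite SubK subUset !sub1set uS vS /=.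
rewrite ffunE SubK => /exists_inP[u' uv_u' /exists_inP[v' uv_v']].
by move: uv_u' uv_v'; rewrite !inE => /orP[]/eqP-> /orP[]/eqP->; rewrite ?eq_col eqxx.
Qed.

(* The k-partite layout: a vertex (i, xi) says that the bits of pigeon i
   are addressed by xi; the 'I_r extra vertices are joined to everything. *)
Definition vertex (b : nat) (A : finType) (r : nat) : Type :=
  (option {set 'I_b} * {ffun 'I_b -> option A} + 'I_r)%type.

Definition pigeon_vertex (b : nat) (A : finType) (r : nat)
    (x : {ffun option {set 'I_b} * 'I_b -> option A})
    (c : option {set 'I_b} + 'I_r) : vertex b A r :=
  match c with
  | inl i => inl (i, [ffun l => x (i, l)])
  | inr s => inr s
  end.

Definition hole (b : nat) (A : finType) (r : nat)
    (y : {ffun option {set 'I_b} * 'I_b -> A}) (w : vertex b A r) :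
    {set 'I_b} + 'I_r :=
  match w with
  | inl (i, xi) => inl [set l | xi l == Some (y (i, l))]
  | inr s => inr s
  end.

(** Alice's clique has one vertex per pigeon, addressed by her entries, plus the extra vertices; Bob
    colors vertices by holes, using [k - 1] colors. A clique edge with equally colored ends shows
    two pigeons in one hole. The maps [alpha], [beta] and [pi] admit protocols for problems into
    which Clique embeds. *)
Lemma clique_protocol_leaves (n k b : nat) (A : finType) (X Y O : Type)
    (p : protocol X Y O)
    (alpha : {G : bits (edge n) | clique k G} -> X)
    (beta : {G : bits (edge n) | ~~ clique k G} -> Y)
    (pi : O -> edge n) :
  (0 < b)%N -> (0 < #|A|)%N -> (2 ^ b < k)%N ->
  ((2 ^ b).+1 * #|A|.+1 ^ b + (k - (2 ^ b).+1) <= n)%N ->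
  (forall G G', let e := pi (run p (alpha G) (beta G')) in
     (sval G e > sval G' e)%N) ->
  (#|A| ^ (2 ^ b - 1) <= leaves p * 2 ^ ((2 ^ b).+1 * b))%N.
Proof.
move=> b_gt0 A_gt0 lt_hk le_n psolves.
set r := (k - (2 ^ b).+1)%N.
have cardC : #|{set 'I_b}| = (2 ^ b)%N.
  by rewrite -cardsT -powersetT card_powerset cardsT card_ord.
have cardV : (#|{: vertex b A r}| <= n)%N.
  apply: leq_trans le_n.
  by rewrite card_sum card_prod card_ffun !card_option cardC !card_ord.
pose iota (w : vertex b A r) : 'I_n := widen_ord cardV (enum_rank w).
have iota_inj : injective iota by move=> w w' /(congr1 val)/= /ord_inj/enum_rank_inj.
pose V x : {set 'I_n} := [set iota (pigeon_vertex x c) | c : option {set 'I_b} + 'I_r].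
have cardVx x : #|V x| = k.
  rewrite card_imset; last first.
    by move=> [i|s] [i'|s'] /iota_inj //= [->].
  by rewrite card_sum card_option cardC card_ord /r subnKC.
pose col (y : {ffun _ -> A}) (v : 'I_n) : {set 'I_b} + 'I_r :=
  if [pick w | iota w == v] is Some w then hole y w else inl set0.
have colE y w : col y (iota w) = hole y w.
  rewrite /col; case: pickP => [w' /eqP/iota_inj-> //|/(_ w)].
  by rewrite eqxx.
have Vclique x : clique k (complete_graph (V x)).
  by rewrite -(cardVx x) clique_complete_graph.
have Cnoclique y : ~~ clique k (coloring_graph (col y)).
  by apply: coloring_graph_no_clique; rewrite card_sum cardC card_ord /r; lia.
have holeE x y i :
    hole y (pigeon_vertex x (inl i : _ + 'I_r)) = inl (slice (matches x y) i).
  by congr inl; apply/setP => l; rewrite !inE ffunE.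
pose good x y o :=
  complete_graph (V x) (pi o) && ~~ coloring_graph (col y) (pi o).
pose G1 x : {G : bits (edge n) | clique k G} := 
  exist (fun G => is_true (clique k G)) _ (Vclique x).
pose G0 y : {G : bits (edge n) | ~~ clique k G} := 
  exist (fun G => is_true (~~ clique k G)) _ (Cnoclique y).
apply: (@pigeon_protocol_leaves b A X Y O p (alpha \o G1) (beta \o G0) good) => //.
  move=> x y; have /= := psolves (G1 x) (G0 y).
  by rewrite /good; case: (complete_graph _ _); case: (coloring_graph _ _).
move=> x0 y0 o.
have /cards2P[u [v [neq_uv eV]]] := valP (pi o).
have goodE x y : good x y o -> [/\ u \in V x, v \in V x & col y u = col y v].
  rewrite /good !ffunE eV subUset !sub1set => /andP[/andP[uV vV]].
  rewrite negb_exists_in => /forall_inP/(_ u); rewrite !inE eqxx => /(_ isT).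
  rewrite negb_exists_in => /forall_inP/(_ v); rewrite !inE eqxx orbT => /(_ isT).
  by rewrite negbK => /eqP.
move=> /goodE[/imsetP[c _ uE] /imsetP[c' _ vE]].
rewrite uE vE !colE.
case: c uE => [i|s] uE; case: c' vE => [i'|s'] vE; rewrite ?holeE //=; last first.
  by move=> [eq_s]; rewrite uE vE eq_s eqxx in neq_uv.
move=> _; exists i, i'; split.
  by apply: contraNneq neq_uv => eq_i; rewrite uE vE eq_i.
(* A vertex records its pigeon and the whole address, so a clique containing it agrees with [x0] on
   pigeon [j]. *)
have Vpv x j : iota (pigeon_vertex x0 (inl j)) \in V x ->
    iota (pigeon_vertex x0 (inl j)) = iota (pigeon_vertex x (inl j)).
  by case/imsetP=> -[j'|s] _ /iota_inj //= [-> ->].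
move=> x y /goodE[]; rewrite uE vE => /Vpv -> /Vpv ->.
by rewrite !colE !holeE => -[].
Qed.

Lemma clique_protocol_leaves_exp (n k b lam : nat) (X Y O : Type)
    (p : protocol X Y O)
    (alpha : {G : bits (edge n) | clique k G} -> X)
    (beta : {G : bits (edge n) | ~~ clique k G} -> Y)
    (pi : O -> edge n) :
  (2 <= b)%N -> (2 ^ b < k <= 2 ^ b.+1)%N ->
  (2 ^ (25 * b ^ 2) <= n)%N -> (2 ^ (lam ^ 2) <= n)%N ->
  (forall G G', let e := pi (run p (alpha G) (beta G')) in
     (sval G e > sval G' e)%N) ->
  (2 ^ (lam + 2 ^ b) <= leaves p)%N.
Proof.
move=> b_ge2 /andP[lt_hk le_k] le_bn le_lamn psolves.
(* The part [4 * b] pays for the factor [2 ^ ((2 ^ b).+1 * b)] and for the gain [2 ^ b]. *)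
pose N := (2 ^ (4 * b + lam))%N.
have h_ge4 : (4 <= 2 ^ b)%N by rewrite (@leq_pexp2l 2 2).
have exp_le : (b.+2 + (4 * b + lam).+1 * b <= maxn (25 * b ^ 2) (lam ^ 2))%N.
  (* Up to [17 * b] the exponent is at most [21 * b ^ 2] plus linear terms; beyond, [lam ^ 2]
     dominates. *)
  rewrite -!mulnn; case: (leqP lam (17 * b)) => le_lam.
    by apply: leq_trans (leq_maxl _ _); nia.
  by apply: leq_trans (leq_maxr _ _); nia.
have le_n : ((2 ^ b).+1 * #|'I_N|.+1 ^ b + (k - (2 ^ b).+1) <= n)%N.
  apply: (@leq_trans (2 ^ (b.+2 + (4 * b + lam).+1 * b))); last first.
    apply: leq_trans (leq_pexp2l _ exp_le) _ => //.
    by case: (leqP (25 * b ^ 2) (lam ^ 2)).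
  rewrite expnD expnS mul2n -addnn mulnDl.
  rewrite card_ord; apply: leq_add.
    apply: leq_mul; first by rewrite expnS; lia.
    rewrite expnM leq_exp2r; last by lia.
    by rewrite /N expnS mul2n -addnn -addn1 leq_add2l expn_gt0.
  apply: leq_trans (leq_subr _ _) (leq_trans le_k _).
  by rewrite leq_pmulr // expn_gt0.
have := clique_protocol_leaves (A := 'I_N) (ltnW b_ge2) _ lt_hk le_n psolves.
rewrite card_ord expn_gt0 => /(_ isT); rewrite -expnM => le_leaves.
rewrite -(@leq_pmul2r (2 ^ ((2 ^ b).+1 * b))) ?expn_gt0 //.
apply: leq_trans le_leaves; rewrite -expnD leq_pexp2l //.
move: (2 ^ b)%N h_ge4 => h h_ge4.
have [g ->] : exists g, h = (g + 4)%N by exists (h - 4)%N; rewrite subnK.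
rewrite addnS subn1 /=; nia.
Qed.

(** * Existence of optimal protocols *)

Lemma protocol_of_fun (X Y : finType) (O : Type) (r : X -> Y -> O) (o0 : O) :
  exists p : protocol X Y O, forall x y, run p x y = r x y.
Proof.
(* Each player compares the input with one value at a time, Alice first. *)
have bob (g : Y -> O) (s : seq Y) :
    exists p : protocol X Y O, forall x y, y \in s -> run p x y = g y.
  elim: s => [|y0 s [p ps]]; first by exists (Leaf _ _ o0).
  exists (Bob (pred1 y0) p (Leaf _ _ (g y0))) => x y /=; rewrite inE.
  by case: eqP => [->//|_ /= /ps->].
suff [p pr] : exists p : protocol X Y O,
    forall x y, x \in enum X -> run p x y = r x y.
  by exists p => x y; rewrite pr ?mem_enum.
elim: (enum X) => [|x0 s [p ps]]; first by exists (Leaf _ _ o0).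
have [q qr] := bob (r x0) (enum Y).
exists (Alice (pred1 x0) p q) => x y /=; rewrite inE.
by case: eqP => [->|_ /= /ps->//]; rewrite qr ?mem_enum.
Qed.

Lemma exists_solution (X Y : finType) (O : Type) (P : problem X Y O) (o0 : O) :
  (forall x y, promise P x y -> exists o, goal P x y o) ->
  exists p : protocol X Y O, solves p P.
Proof.
move=> Pgoal.
have /choice[r rP] : forall xy : X * Y,
    exists o, promise P xy.1 xy.2 -> goal P xy.1 xy.2 o.
  move=> [x y] /=; have [/Pgoal[o]|nP] := pselect (promise P x y); first by exists o.
  by exists o0.
have [p pr] := protocol_of_fun (fun x y => r (x, y)) o0.
by exists p => x y Pxy; rewrite pr; apply: (rP (x, y)).
Qed.

Lemma least_in (A : set nat) : (exists n, A n) -> A (least A).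
Proof.
move=> [n An]; rewrite /least; case: xgetP => [k _ []//|no_min].
have exA : exists k, `[< A k >] by exists n; apply/asboolP.
case: (ex_minnP exA) => k /asboolP Ak min_k; case: (no_min k); split=> // j Aj.
by apply: min_k; apply/asboolP.
Qed.

Lemma L_attained (X Y : finType) (O : Type) (P : problem X Y O) (o0 : O) :
  (forall x y, promise P x y -> exists o, goal P x y o) ->
  exists2 p : protocol X Y O, solves p P & leaves p = L P.
Proof.
move=> /(exists_solution o0)[p pP].
by have [|q [qP eq_q]] := @least_in [set l | exists p : protocol X Y O,
  solves p P /\ leaves p = l]%classic; [exists (leaves p), p|exists q].
Qed.

Lemma CC_attained (X Y : finType) (O : Type) (P : problem X Y O) (o0 : O) :
  (forall x y, promise P x y -> exists o, goal P x y o) ->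
  exists2 p : protocol X Y O, solves p P & depth p = CC P.
Proof.
move=> /(exists_solution o0)[p pP].
by have [|q [qP eq_q]] := @least_in [set l | exists p : protocol X Y O,
  solves p P /\ depth p = l]%classic; [exists (depth p), p|exists q].
Qed.

Lemma leaves_le_depth (X Y O : Type) (p : protocol X Y O) :
  (leaves p <= 2 ^ depth p)%N.
Proof.
elim: p => [//|q p0 IH0 p1 IH1|q p0 IH0 p1 IH1] /=;
  rewrite expnS mulSn mul1n leq_add //.
- by rewrite (leq_trans IH0) // leq_pexp2l // leq_maxl.
- by rewrite (leq_trans IH1) // leq_pexp2l // leq_maxr.
- by rewrite (leq_trans IH0) // leq_pexp2l // leq_maxl.
- by rewrite (leq_trans IH1) // leq_pexp2l // leq_maxr.
Qed.

(** * Monotonicity and embedding by repeated rows *)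

Lemma clique_monotone (n k : nat) : monotone (@clique n k).
Proof.
move=> G G' leG; case cG: (clique k G); last by [].
suff -> : clique k G' by [].
move: cG => /existsP[S /andP[cardS /forallP GS]]; apply/existsP; exists S.
rewrite cardS /=; apply/forallP => e; apply/implyP => /(implyP (GS e)) Ge.
by have := leG e; rewrite Ge; case: (G' e).
Qed.

Lemma compose_monotone (J I : finType) (f : bits J -> bool) (g : bits I -> bool) :
  monotone f -> monotone g -> monotone (compose f g).
Proof.
move=> mf mg x y le_xy; apply: mf => j; rewrite !ffunE; apply: mg => i.
by rewrite !ffunE.
Qed.

Lemma monotone_separated (I : finType) (h : bits I -> bool) (x y : bits I) :
  monotone h -> h x -> ~~ h y -> exists i, (x i > y i)%N.
Proof.
move=> mh hx hy; apply/existsP; apply: contraNT hy.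
rewrite negb_exists => /forallP le_xy.
have : (h x <= h y)%N by apply: mh => i; rewrite leqNgt le_xy.
by rewrite hx; case: (h y).
Qed.

Lemma monotone_nonconstant (I : finType) (f : bits I -> bool) :
  monotone f -> nonconstant f -> f [ffun=> true] /\ ~~ f [ffun=> false].
Proof.
move=> mf [x [y neq_f]].
have le1 z : (f z <= f [ffun=> true])%N by apply: mf => i; rewrite ffunE leq_b1.
have ge0 z : (f [ffun=> false] <= f z)%N by apply: mf => i; rewrite ffunE.
move: neq_f (le1 x) (le1 y) (ge0 x) (ge0 y).
by case: (f x); case: (f y); case: (f [ffun=> true]); case: (f [ffun=> false]).
Qed.

Definition repeat_rows (J I : finType) (x : bits I) : bits (J * I) :=
  [ffun q => x q.2].

Lemma rowfun_repeat_rows (J I : finType) (g : bits I -> bool) (x : bits I) :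
  rowfun g (repeat_rows J x) = [ffun=> g x].
Proof.
apply/ffunP => j; rewrite !ffunE; congr g.
by apply/ffunP => i; rewrite !ffunE.
Qed.

(** With equal rows, [f] sees a constant vector and returns the clique bit; the column of the answer
    is then a correct edge. *)
Lemma compose_clique_leaves (m n k b lam : nat) (f : bits 'I_m -> bool)
    (p : protocol {x : bits ('I_m * edge n) | compose f (@clique n k) x}
       {x : bits ('I_m * edge n) | ~~ compose f (@clique n k) x} ('I_m * edge n)) :
  monotone f -> nonconstant f ->
  (2 <= b)%N -> (2 ^ b < k <= 2 ^ b.+1)%N ->
  (2 ^ (25 * b ^ 2) <= n)%N -> (2 ^ (lam ^ 2) <= n)%N ->
  solves p (mKW_compose f (@clique n k)) -> (2 ^ (lam + 2 ^ b) <= leaves p)%N.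
Proof.
move=> mf ncf b_ge2 kb bn ln psolves.
have [f1 f0] := monotone_nonconstant mf ncf.
have alphaP (G : {G : bits (edge n) | clique k G}) :
    compose f (@clique n k) (repeat_rows 'I_m (sval G)).
  by rewrite /compose rowfun_repeat_rows (svalP G).
have betaP (G : {G : bits (edge n) | ~~ clique k G}) :
    ~~ compose f (@clique n k) (repeat_rows 'I_m (sval G)).
  by rewrite /compose rowfun_repeat_rows (negPf (svalP G)).
pose alpha G : {x | compose f (@clique n k) x} :=
  exist (fun x => is_true (compose f (@clique n k) x)) _ (alphaP G).
pose beta G : {x | ~~ compose f (@clique n k) x} :=
  exist (fun x => is_true (~~ compose f (@clique n k) x)) _ (betaP G).
apply: (clique_protocol_leaves_exp (p := p) (alpha := alpha) (beta := beta)
  (pi := snd) b_ge2 kb bn ln) => G G' /=.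
by have /= := psolves (alpha G) (beta G') I; rewrite !ffunE.
Qed.

(** Repeated rows make [a] all ones and [b] all zeros, so only the first alternative of the goal
    remains. *)
Lemma U_compose_clique_leaves (m n k b lam : nat)
    (p : protocol (bits ('I_m * edge n)) (bits ('I_m * edge n)) ('I_m * edge n)) :
  (0 < m)%N ->
  (2 <= b)%N -> (2 ^ b < k <= 2 ^ b.+1)%N ->
  (2 ^ (25 * b ^ 2) <= n)%N -> (2 ^ (lam ^ 2) <= n)%N ->
  solves p (U_compose_mKW m (@clique n k)) -> (2 ^ (lam + 2 ^ b) <= leaves p)%N.
Proof.
move=> m_gt0 b_ge2 kb bn ln psolves.
apply: (clique_protocol_leaves_exp (p := p) (pi := snd)
  (alpha := fun G => repeat_rows 'I_m (sval G))
  (beta := fun G => repeat_rows 'I_m (sval G)) b_ge2 kb bn ln).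
move=> G G' /=.
have := psolves (repeat_rows 'I_m (sval G)) (repeat_rows 'I_m (sval G')).
rewrite /= !rowfun_repeat_rows (svalP G) (negPf (svalP G')).
case=> [/ffunP/(_ (Ordinal m_gt0))||[]|[]]; rewrite !ffunE //.
by case.
Qed.

(** * Logarithms and the size of n *)

Lemma ln2_gt0 (R : realType) : 0 < ln 2 :> R.
Proof. by rewrite ln_gt0 // ltr1n. Qed.

Lemma le_log2 (R : realType) (a l : nat) :
  (2 ^ a <= l)%N -> a%:R <= log2 (l%:R : R).
Proof.
move=> le_al; rewrite /log2 ler_pdivlMr ?ln2_gt0 // mulr_natl -lnXn ?ltr0n //.
have l_gt0 : (0 < l)%N by rewrite (leq_trans _ le_al) // expn_gt0.
by rewrite ler_ln ?posrE ?exprn_gt0 ?ltr0n // -natrX ler_nat.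
Qed.

Lemma log2_le (R : realType) (a l : nat) :
  (l <= 2 ^ a)%N -> log2 (l%:R : R) <= a%:R.
Proof.
case: l => [_|l le_la]; first by rewrite /log2 ln0 // mul0r.
rewrite /log2 ler_pdivrMr ?ln2_gt0 // mulr_natl -lnXn ?ltr0n //.
by rewrite ler_ln ?posrE ?exprn_gt0 ?ltr0n // -natrX ler_nat.
Qed.

Lemma quasipolynomial_bound (R : realType) (n k b : nat) :
  (0 < b)%N -> (2 ^ b <= k)%N ->
  k%:R <= 2 `^ (5^-1 * Num.sqrt (log2 (n%:R : R))) ->
  (2 ^ (25 * b ^ 2) <= n)%N.
Proof.
move=> b_gt0 le_bk le_k; set s := Num.sqrt _ in le_k.
have k_gt0 : (0 < k)%N by rewrite (leq_trans _ le_bk) // expn_gt0.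
have le_bs : 5 * b%:R <= s.
  rewrite -ler_pdivlMl ?ltr0n //; apply: le_trans (le_log2 R le_bk) _.
  rewrite /log2 ler_pdivrMr ?ln2_gt0 // -ln_powR ler_ln // posrE ?ltr0n //.
  by rewrite powR_gt0.
have s_gt0 : 0 < s by apply: lt_le_trans le_bs; rewrite mulr_gt0 ?ltr0n.
have t_gt0 : 0 < log2 (n%:R : R) by rewrite -sqrtr_gt0.
(* The convention [ln 0 = 0] excludes [n = 0] here. *)
have n_gt0 : (0 < n)%N.
  by case: (n) t_gt0 => [|//]; rewrite /log2 ln0 // mul0r ltxx.
have : (25 * b ^ 2)%:R <= log2 (n%:R : R).
  rewrite -[leRHS]sqr_sqrtr ?(ltW t_gt0) // -/s natrM natrX.
  rewrite (_ : 25%:R = 5 ^+ 2) -?exprMn; last by rewrite -natrX.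
  by rewrite ler_pXn2r // nnegrE ?(ltW s_gt0) ?mulr_ge0.
rewrite /log2 ler_pdivlMr ?ln2_gt0 // mulr_natl -lnXn ?ltr0n //.
by rewrite ler_ln ?posrE ?exprn_gt0 ?ltr0n // -natrX ler_nat.
Qed.

Theorem theorem6p10 (R : realType) :
  exists eps : R, 0 < eps /\
  exists (kappa1 kappa2 : R) (N1 N2 : nat), 0 < kappa1 /\ 0 < kappa2 /\
  forall m : nat, exists n0 : nat,
  forall f : bits 'I_m -> bool, monotone f -> nonconstant f ->
  forall n : nat, (n0 <= n)%N ->
  forall k : nat, (2 <= k)%N ->
    k%:R <= 2 `^ (eps * Num.sqrt (log2 (n%:R : R))) ->
    ((N1 <= k)%N ->
       log2 (L (mKW_compose f (@clique n k)))%:R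
         >= log2 (L (mKW f))%:R + kappa1 * k%:R) /\
    ((N2 <= k)%N ->
       (CC (U_compose_mKW m (@clique n k)))%:R >= m%:R + kappa2 * k%:R).
Proof.
(* The square of 5 is the 25 required by [clique_protocol_leaves_exp]. *)
exists 5^-1; split; first by rewrite invr_gt0.
(* [k <= 2 ^ b.+1] gives [2 ^ b >= k / 2], and [k >= 5] gives [b >= 2]. *)
exists 2^-1, 2^-1, 5, 5; do 2 (split; first by rewrite invr_gt0).
move=> m.
(* The maximum over all [g] makes the threshold depend on [m] alone; the summand [m] serves the
   second bound. *)
pose lam := (m + \max_(g : {ffun bits 'I_m -> bool}) L (mKW g))%N.
exists (2 ^ (lam ^ 2))%N => f mf ncf n le_lamn k k_ge2 le_k.
suff main : (5 <= k)%N -> exists b : nat,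
    [/\ (2 <= b)%N, (2 ^ b < k <= 2 ^ b.+1)%N & (2 ^ (25 * b ^ 2) <= n)%N].
  have half b : (2 ^ b < k <= 2 ^ b.+1)%N -> 2^-1 * k%:R <= (2 ^ b)%:R :> R.
    by move=> /andP[_ le_kb]; rewrite ler_pdivrMl ?ltr0n // -natrM ler_nat -expnS.
  have m_gt0 : (0 < m)%N.
    case: (posnP m) => // m0; case: ncf => x [y /eqP[]]; congr f.
    by apply/ffunP => i; have := ltn_ord i; rewrite {2}m0.
  (* An edge is needed as the default output of the exhaustive protocol. *)
  have edge0 : (5 <= k)%N -> edge n.
    move=> k_ge5; have n_ge2 : (2 <= n)%N.
      have [b [b_ge2 _]] := main k_ge5; apply: leq_trans.
      by rewrite -[X in (X <= _)%N](expn1 2) leq_pexp2l // muln_gt0 expn_gt0 (ltnW b_ge2).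
    exists [set Ordinal (ltnW n_ge2); Ordinal n_ge2].
    by rewrite cards2 -val_eqE.
  split=> k_ge5; have [b [b_ge2 kb bn]] := main k_ge5.
  - have [x y _|p psolves <-] := L_attained (P := mKW_compose f (@clique n k))
        (Ordinal m_gt0, edge0 k_ge5).
      exact: monotone_separated (compose_monotone mf (@clique_monotone n k))
        (svalP x) (svalP y).
    have := le_log2 R (compose_clique_leaves mf ncf b_ge2 kb bn le_lamn psolves).
    apply: le_trans; rewrite natrD; apply: lerD; last exact: half.
    (* The crude bound [l < 2 ^ l] suffices, since [lam] dominates the leaf count itself. *)
    apply: log2_le; apply: leq_trans (ltnW (ltn_expl _ (isT : 1 < 2)%N)) _.
    rewrite leq_pexp2l // /lam -(_ : finfun f = f :> (_ -> _)); last first.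
      by apply: funext => x; rewrite ffunE.
    by apply: leq_trans (leq_addl _ _); apply: leq_bigmax.
  - have [X Y /= neq_ab|p psolves <-] := CC_attained
        (P := U_compose_mKW m (@clique n k)) (Ordinal m_gt0, edge0 k_ge5).
      have [i] : exists i, rowfun (@clique n k) X i != rowfun (@clique n k) Y i.
        apply/existsP; apply: contra_notT neq_ab; rewrite negb_exists => /forallP ab.
        by apply/ffunP => i; apply/eqP; have := ab i; rewrite negbK.
      rewrite !ffunE => neq_i.
      case cX: (clique _ _) neq_i; case cY: (clique _ _) => // _.
        have [e] := monotone_separated (@clique_monotone n k) cX (negbT cY).
        by rewrite !ffunE => ?; exists (i, e); apply: Or31; rewrite !ffunE cX cY.
      have [e] := monotone_separated (@clique_monotone n k) cY (negbT cX).
      by rewrite !ffunE => ?; exists (i, e); apply: Or32; rewrite !ffunE cX cY.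
    have := U_compose_clique_leaves m_gt0 b_ge2 kb bn le_lamn psolves.
    move=> /leq_trans/(_ (leaves_le_depth p)); rewrite leq_exp2l // => le_depth.
    apply: le_trans (_ : (lam + 2 ^ b)%:R <= _); last by rewrite ler_nat.
    by rewrite natrD lerD ?half // ler_nat leq_addr.
(* Using [k.-1] keeps [2 ^ b < k] strict when [k] is a power of two. *)
move=> k_ge5; pose b := trunc_log 2 k.-1.
have /andP[le_b lt_b] : (2 ^ b <= k.-1 < 2 ^ b.+1)%N.
  by apply: trunc_log_bounds => //; lia.
have b_ge2 : (2 <= b)%N by rewrite trunc_log_max //; lia.
exists b; split=> //.
  by apply/andP; split; lia.
by apply: quasipolynomial_bound le_k; [exact: ltnW|lia].
Qed.
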